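(* Let $\kappa$ be a cardinal with $\kappa^{<\kappa}=\kappa$, let $\mathcal L$ be a relational language of size $\le\kappa$, and let $\mathcal K\subseteq\mathrm{Mod}^\kappa_{\mathcal L}$ be an invariant set. Then for every $A\subseteq\mathcal K$: $A$ is $\kappa^+$-Borel in $\mathcal K$ and closed under isomorphism if and only if there is an $\mathcal L_{\kappa^+\kappa}$-sentence $\sigma$ with $A=\mathrm{Mod}^\kappa_\sigma\cap\mathcal K$. Moreover, if $A$ is $\kappa^+$-Borel and closed under isomorphism, then $\sigma$ can be chosen with $R(\sigma)\le\max\{\mathrm{rk}_B(A),1\}$.
   Context: ${}^\kappa\kappa$ has the bounded topology generated by $N_p=\{x:p\subseteq x\}$, $p\in{}^{<\kappa}\kappa$. $\mathrm{Mod}^\kappa_{\mathcal L}$ is the space of $\mathcal L$-structures with domain $\kappa$ (coded by characteristic functions of the relations), with topology generated by $N_{\mathcal Q}=\{\mathcal M:\mathcal Q$ is a substructure of the $\mathcal L'$-reduct of $\mathcal M\}$, $\mathcal L'\subseteq\mathcal L$ of size $<\kappa$, $\mathcal Q$ an $\mathcal L'$-structure with domain bounded in $\kappa$; it is homeomorphic to ${}^\kappa2$. Invariant set = subset closed under isomorphism, with subspace topology. $\kappa^+$-Borel sets of $\mathcal K$ = $\kappa^+$-algebra generated by its open sets. Borel classes: $\boldsymbol\Sigma^0_1$ open, $\boldsymbol\Pi^0_1$ closed, $\boldsymbol\Sigma^0_\alpha$ ($\alpha\ge2$) = $\kappa$-unions of sets in $\bigcup_{1\le\beta<\alpha}\boldsymbol\Pi^0_\beta$,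 $\boldsymbol\Pi^0_\alpha$ = complements; $\mathrm{rk}_B(A)$ (relative to $\mathcal K$) is $0$ if $A$ is clopen, else the least $\alpha\ge1$ with $A\in\boldsymbol\Sigma^0_\alpha(\mathcal K)\cup\boldsymbol\Pi^0_\alpha(\mathcal K)$. $\mathcal L_{\kappa^+\kappa}$ allows conjunctions/disjunctions of length $\le\kappa$ and quantification over sequences of $<\kappa$ variables. $\mathrm{Mod}^\kappa_\sigma=\{\mathcal M\in\mathrm{Mod}^\kappa_{\mathcal L}:\mathcal M\models\sigma\}$. Quantifier rank $R$: $0$ for atomic, $R(\neg\psi)=R(\psi)$, $R(\bigwedge_j\psi_j)=\sup_jR(\psi_j)$, $R(\exists\bar x\,\psi)=R(\psi)+1$. *)

(* Defs.v *)
From HB Require Import structures.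
From mathcomp Require Import all_boot all_order.
From mathcomp Require Import all_classical.
From mathcomp Require Import topology_structure initial_topology.

Set Implicit Arguments.
Unset Strict Implicit.
Unset Printing Implicit Defensive.

Local Open Scope classical_set_scope.
Local Open Scope card_scope.

Definition card_lt (S T : Type) (A : set S) (B : set T) : Prop :=
  A #<= B /\ ~ (B #<= A).

(* A cardinal kappa is an initial ordinal: a well-order each of whose proper
   initial segments, i.e. the ordinals a < kappa, has smaller cardinality. *)
Definition below (d : Order.disp_t) (kappa : orderType d) (a : kappa) :
  set kappa := [set b | (b < a)%O].

Definition infinite_cardinal (d : Order.disp_t) (kappa : orderType d) : Prop :=
  [/\ infinite_set [set: kappa],
      well_founded (fun a b : kappa => (a < b)%O) &
      forall a : kappa, card_lt (below a) [set: kappa]].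

(* The set ^{<kappa}kappa, so that kappa^{<kappa} is its cardinality. *)
Definition short_seq (d : Order.disp_t) (kappa : orderType d) : Type :=
  {a : kappa & below a -> kappa}.

Definition bounded (d : Order.disp_t) (kappa : orderType d) (D : set kappa) :
  Prop := exists a : kappa, D `<=` below a.

(* The ordinals below kappa^+: exactly those obtained from 0 by successors and
   suprema of at most kappa many ordinals. Distinct terms may denote the same
   ordinal; equality of ordinals is oeq. In ole, a successor osucc a' is <= b
   when a' < b, which is decided by recursion on b. *)
Inductive ord (kappa : Type) : Type :=
| ozero
| osucc of ord kappa
| osup (D : set kappa) of (D -> ord kappa).
Arguments ozero {kappa}.

Fixpoint ole (kappa : Type) (a b : ord kappa) {struct a} : Prop :=
  match a with
  | ozero => True
  | osucc a' =>
      (fix lt_a' (b : ord kappa) : Prop :=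
         match b with
         | ozero => False
         | osucc b' => ole a' b'
         | osup _ g => exists j, lt_a' (g j)
         end) b
  | osup _ f => forall i, ole (f i) b
  end.

Definition olt (kappa : Type) (a b : ord kappa) : Prop := ole (osucc a) b.
Definition oeq (kappa : Type) (a b : ord kappa) : Prop := ole a b /\ ole b a.
Definition oone (kappa : Type) : ord kappa := osucc ozero.
Definition otwo (kappa : Type) : ord kappa := osucc (oone kappa).
Arguments oone {kappa}.
Arguments otwo {kappa}.

Definition omax (kappa : Type) (a b : ord kappa) : ord kappa :=
  if `[< ole a b >] then b else a.

HB.instance Definition _ (kappa : Type) := gen_eqMixin (ord kappa).
HB.instance Definition _ (kappa : Type) := gen_choiceMixin (ord kappa).

Definition kplus_algebra (kappa T : Type) (F : set (set T)) : Prop :=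
  (forall A, F A -> F (~` A)) /\
  (forall (D : set kappa) (B : kappa -> set T),
     (forall i, D i -> F (B i)) -> F (\bigcup_(i in D) B i)).

Definition kplus_borel (kappa : Type) (T : topologicalType) :
  set (set T) := smallest (@kplus_algebra kappa T) [set U | open U].
Arguments kplus_borel kappa {T} _.

Inductive Sigma0 (kappa : Type) (T : topologicalType) :
    ord kappa -> set T -> Prop :=
| Sigma0_one a A : oeq a oone -> open A -> Sigma0 a A
| Sigma0_union a (b : kappa -> ord kappa) (B : kappa -> set T) :
    ole otwo a ->
    (forall i, ole oone (b i) /\ olt (b i) a) ->
    (forall i, Pi0 (b i) (B i)) ->
    Sigma0 a (\bigcup_i B i)
with Pi0 (kappa : Type) (T : topologicalType) : ord kappa -> set T -> Prop :=
| Pi0_compl a A : Sigma0 a A -> Pi0 a (~` A).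

Definition borel_level (kappa : Type) (T : topologicalType) (A : set T) :
  set (ord kappa) := [set a | ole oone a /\ (Sigma0 a A \/ Pi0 a A)].

Definition is_least (kappa : Type) (P : set (ord kappa)) (a : ord kappa) :
  Prop := P a /\ forall b, P b -> ole a b.

(* Only meaningful (and then well defined up to oeq) if A is kplus_borel. *)
Definition rkB (kappa : Type) (T : topologicalType) (A : set T) : ord kappa :=
  if `[< clopen A >] then ozero
  else xget ozero [set a | is_least (borel_level A) a].
Arguments rkB kappa {T} A.

Record language : Type := Language {
  symb :> Type;
  arity : symb -> nat }.

Definition structure (L : language) (X : Type) : Type :=
  forall r : L, set ('I_(arity r) -> X).

Definition sublanguage (L : language) (S : set L) : language :=
  Language (fun r : S => arity (set_val r)).

Definition reduct (L : language) (S : set L) (X : Type) (M : structure L X) :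
  structure (sublanguage S) X := fun r => M (set_val r).
Arguments reduct {L} S {X} M.

Definition is_substructure (L : language) (X : Type) (D : set X)
    (Q : structure L D) (M : structure L X) : Prop :=
  forall (r : L) (t : 'I_(arity r) -> D), Q r t <-> M r (set_val \o t).

Definition Mod (L : language) (d : Order.disp_t) (kappa : orderType d) : Type :=
  structure L kappa.

Definition Mod_basic (L : language) (d : Order.disp_t) (kappa : orderType d) :
  set (set (Mod L kappa)) :=
  [set N | exists (S : set L) (D : set kappa) (Q : structure (sublanguage S) D),
     [/\ card_lt S [set: kappa], bounded D &
         N = [set M | is_substructure Q (reduct S M)]]].

HB.instance Definition _ (L : language) (d : Order.disp_t) (kappa : orderType d)
  := gen_eqMixin (Mod L kappa).
HB.instance Definition _ (L : language) (d : Order.disp_t) (kappa : orderType d)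
  := gen_choiceMixin (Mod L kappa).
HB.instance Definition _ (L : language) (d : Order.disp_t) (kappa : orderType d)
  := isSubBaseTopological.Build (Mod L kappa) (@Mod_basic L d kappa) id.

Definition isomorphic (L : language) (X : Type) (M N : structure L X) : Prop :=
  exists2 f : X -> X, bijective f &
    forall (r : L) (t : 'I_(arity r) -> X), M r t <-> N r (f \o t).

Definition iso_invariant (L : language) (d : Order.disp_t) (kappa : orderType d)
    (A : set (Mod L kappa)) : Prop :=
  forall M N : Mod L kappa, isomorphic M N -> A M -> A N.

Definition subsp (T : topologicalType) (K : set T) : Type :=
  initial_topology (set_val : K -> T).
HB.instance Definition _ (T : topologicalType) (K : set T) :=
  Topological.on (subsp K).

Definition trace (T : topologicalType) (K A : set T) : set (subsp K) :=
  (set_val : K -> T) @^-1` A.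
Arguments trace {T} K A.

(* Formulas of L_{kappa^+ kappa}. The variables are the elements of kappa:
   kappa many suffice, as a subformula of a sentence has fewer than kappa free
   variables. Conjunctions are indexed by arbitrary subsets of kappa. *)
Inductive formula (L : language) (d : Order.disp_t) (kappa : orderType d) :
    Type :=
| feq of kappa & kappa
| frel (r : L) of ('I_(arity r) -> kappa)
| fnot of formula L kappa
| fand (D : set kappa) of (D -> formula L kappa)
| fex of short_seq kappa & formula L kappa.

Definition bound_vars (d : Order.disp_t) (kappa : orderType d)
  (x : short_seq kappa) : set kappa := range (projT2 x).

Fixpoint sat (L : language) (d : Order.disp_t) (kappa : orderType d)
    (M : Mod L kappa) (s : kappa -> kappa) (phi : formula L kappa) : Prop :=
  match phi with
  | feq x y => s x = s y
  | frel r t => M r (s \o t)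
  | fnot psi => ~ sat M s psi
  | fand _ f => forall j, sat M s (f j)
  | fex x psi => exists2 s' : kappa -> kappa,
      (forall v, ~ bound_vars x v -> s' v = s v) & sat M s' psi
  end.

Fixpoint free_vars (L : language) (d : Order.disp_t) (kappa : orderType d)
    (phi : formula L kappa) : set kappa :=
  match phi with
  | feq x y => [set x; y]
  | frel _ t => range t
  | fnot psi => free_vars psi
  | fand _ f => \bigcup_j free_vars (f j)
  | fex x psi => free_vars psi `\` bound_vars x
  end.

Definition sentence (L : language) (d : Order.disp_t) (kappa : orderType d)
  (phi : formula L kappa) : Prop := free_vars phi = set0.

Definition models (L : language) (d : Order.disp_t) (kappa : orderType d)
  (M : Mod L kappa) (phi : formula L kappa) : Prop := forall s, sat M s phi.

Definition Mod_of (L : language) (d : Order.disp_t) (kappa : orderType d)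
  (phi : formula L kappa) : set (Mod L kappa) := [set M | models M phi].

Fixpoint qrank (L : language) (d : Order.disp_t) (kappa : orderType d)
    (phi : formula L kappa) : ord kappa :=
  match phi with
  | feq _ _ | frel _ _ => ozero
  | fnot psi => qrank psi
  | fand _ f => osup (fun j => qrank (f j))
  | fex _ psi => osucc (qrank psi)
  end.

(* Main.v *)
(* A Borel set is evaluated on the pullbacks of a structure M along bijections g
   of kappa, where g is a union of conditions, i.e. of injections of ordinals
   c < kappa into kappa. For a set B of Borel class Sigma_a one finds formulas
   phi k c of rank < a in the variables below c such that, for all g in a
   comeager set depending on M, the pullback of M along g is in B iff
   M |= phi k c (g) for some k and c (Vaught's transform). For open B the
   formulas describe basic neighbourhoods. A union of complements ~B i is handled
   by forcing: phi i c says that no extension of the current condition satisfies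
   a formula of B i, which costs one quantifier over fewer than kappa variables.
   If A is invariant, the truth value of "the pullback of M is in A" does not
   depend on g, so A is defined by the sentence saying that some condition
   satisfies some phi k c; this adds the last quantifier. The Baire category
   argument works for kappa many dense sets because kappa^{<kappa} = kappa forces
   kappa to be regular. *)

Require Import Defs.
From HB Require Import structures.
From mathcomp Require Import all_boot all_order.
From mathcomp Require Import all_classical.
From mathcomp Require Import topology_structure initial_topology.

Local Open Scope classical_set_scope.
Local Open Scope card_scope.

Import Order.TTheory.

(** * Ordinals *)

Section Ordinals.
Context {kappa : Type}.
Implicit Types a b c : ord kappa.

Lemma ole_trans a b c : ole a b -> ole b c -> ole a c.
Proof.
elim: a b c => [//|a IHa|D f IHf] b c; last first.
  by move=> fb bc i; apply: IHf (fb i) bc.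
elim: b c => [//|b _|D g IHg] c.
  elim: c => [//|c _|D g IHg] /=; first exact: IHa.
  by move=> ab [j bj]; exists j; apply: IHg.
by move=> [j aj] gc; apply: (IHg j) => //; apply: gc.
Qed.

Lemma ole_sup {D : set kappa} (f : D -> ord kappa) i a :
  ole a (f i) -> ole a (osup f).
Proof.
elim: a => [//|a _|E g IHg] /=; first by exists i.
by move=> gf j; apply: IHg.
Qed.

Lemma ole_refl a : ole a a.
Proof. by elim: a => [//|//|D f IHf] i; apply: ole_sup (IHf i). Qed.

Lemma ole_succ a : ole a (osucc a).
Proof.
elim: a => [//|//|D f IHf] i; apply: ole_trans (IHf i) _.
exact: (ole_sup f i _ (ole_refl _)).
Qed.

Lemma oltW {a b} : olt a b -> ole a b.
Proof. exact/ole_trans/ole_succ. Qed.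

Lemma oltNge a b : ~ ole a b -> olt b a.
Proof.
elim: a b => [b /(_ I)//|a IHa|D f IHf] b.
  elim: b => [//|b _|D g IHg] /=; first exact: IHa.
  by move=> /forallNP nag i; apply: IHg.
by move=> /existsNP[i nfb]; exists i; apply: IHf.
Qed.

(** Induction on a term [a] that bounds some member of [P]: either a member of [P] lies below an
    immediate subterm of [a], or by linearity ([oltNge]) the bounded member is already least. *)
Lemma ex_is_least (P : set (ord kappa)) b : P b -> exists a, is_least P a.
Proof.
suff H a : forall b, ole b a -> P b -> exists a, is_least P a.
  by move=> Pb; apply: (H b b) => //; apply: ole_refl.
elim: a => [|a IHa|D f IHf] {}b ba Pb.
- by exists b; split => // c _; apply: ole_trans ba _.
- have [[c Pc ca]|/forall2NP nP] := pselect (exists2 c, P c & ole c a).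
    exact: IHa ca Pc.
  exists b; split=> // c Pc; apply: ole_trans ba _.
  by apply: oltNge => ca; case: (nP c).
- have [[c [i [Pc ci]]]|nP] := pselect (exists c i, P c /\ ole c (f i)).
    exact: IHf ci Pc.
  exists b; split=> // c Pc; apply: ole_trans ba _ => i.
  by apply/oltW/oltNge => ci; apply: nP; exists c, i.
Qed.

End Ordinals.

(** Course-of-values recursion without dependent types: [F] receives the earlier values as a total
    function, padded with [x0]. *)
Lemma wf_rec {T : Type} {R : T -> T -> Prop} (wfR : well_founded R) {X : Type}
    (x0 : X) (F : T -> (T -> X) -> X) :
  exists h, forall i, h i = F i (fun j => if pselect (R j i) then h j else x0).
Proof.
pose G i (h : forall j, R j i -> X) :=
  F i (fun j => match pselect (R j i) with left r => h j r | right _ => x0 end).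
exists (Fix wfR (fun _ => X) G) => i; rewrite Fix_eq => [|x f g fg].
  by congr F; apply/funext => j; case: pselect.
by congr F; apply/funext => j; case: pselect.
Qed.

Lemma wf_min {d : Order.disp_t} {T : orderType d}
    (wf : well_founded (fun a b : T => (a < b)%O)) {P : set T} {x : T} : P x ->
  exists2 m, P m & forall y, P y -> (m <= y)%O.
Proof.
elim/(well_founded_ind wf): x => x IHx Px.
have [[y yx Py]|nP] := pselect (exists2 y, (y < x)%O & P y); first exact: IHx Py.
by exists x => // y Py; rewrite leNgt; apply/negP => yx; apply: nP; exists y.
Qed.

Lemma card_le_surj {T U : Type} {A : set T} {B : set U} : A #<= B ->
  A = set0 \/ exists g : U -> T, A = g @` B.
Proof. by move=> /pfcard_geP[|/surjfunPex]; [left|right]. Qed.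

(** * Consequences of kappa^{<kappa} = kappa *)

Record kappa_coding {d : Order.disp_t} (kappa : orderType d) := KappaCoding {
  kwf : well_founded (fun a b : kappa => (a < b)%O);
  kzero : kappa;
  kzero_le : forall x, (kzero <= x)%O;
  kgt : forall a : kappa, exists b, (a < b)%O;
  ksmall : forall (a : kappa) (f : kappa -> kappa),
    exists y, forall x, (x < a)%O -> f x <> y;
  kregular : forall (a : kappa) (f : kappa -> kappa),
    exists b, forall i, (i < a)%O -> (f i < b)%O;
  (* klen and kap enumerate ^{<kappa}kappa: the j-th sequence has length klen j
     and entries kap j i for i < klen j; kap j i is junk beyond. *)
  klen : kappa -> kappa;
  kap : kappa -> kappa -> kappa;
  kenum : forall a h, exists j,
    klen j = a /\ forall i, (i < a)%O -> kap j i = h i;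
  kfst : kappa -> kappa;
  ksnd : kappa -> kappa;
  kpair : forall x y, exists j, kfst j = x /\ ksnd j = y }.

Arguments kwf {d kappa}.
Arguments kzero {d kappa}.
Arguments kzero_le {d kappa}.
Arguments kgt {d kappa}.
Arguments ksmall {d kappa}.
Arguments kregular {d kappa}.
Arguments klen {d kappa}.
Arguments kap {d kappa}.
Arguments kenum {d kappa}.
Arguments kfst {d kappa}.
Arguments ksnd {d kappa}.
Arguments kpair {d kappa}.

Section Cardinal.
Context {d : Order.disp_t} {kappa : orderType d}.
Hypothesis kappa_card : infinite_cardinal kappa.

Lemma no_surj_below (a : kappa) (f : kappa -> kappa) :
  exists y, forall x, (x < a)%O -> f x <> y.
Proof.
apply: contrapT => /forallNP nf; case: kappa_card => _ _ /(_ a)[_]; apply.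
have -> : [set: kappa] = f @` below a.
  apply/seteqP; split=> y //= _.
  by have /existsNP[x /not_implyP[xa /contrapT fx]] := nf y; exists x.
exact: card_image_le.
Qed.

(** Hilbert's hotel: if [a] were the maximum, [below a] would still be infinite, and shifting along
    a copy of [nat] inside it would make room for [a], so that [below a] would map onto [kappa]. *)
Lemma exists_gt (a : kappa) : exists b, (a < b)%O.
Proof.
apply: contrapT => /forallNP amax.
have ale x : (x <= a)%O by rewrite leNgt; apply/negP/amax.
have fina : infinite_set (below a).
  case: kappa_card => inf _ _ fin; apply: inf.
  rewrite (_ : setT = below a `|` [set a]); first by rewrite finite_setU.
  apply/seteqP; split => x //= _; move: (ale x); rewrite le_eqVlt.
  by move=> /orP[/eqP|]; [right|left].
have [g ginj gb] : exists2 g : nat -> kappa,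
    injective g & forall n, below a (g n).
  have := fina; rewrite infiniteP => /card_leP[g].
  have memn (n : nat) : n \in [set: nat] by rewrite inE.
  exists (fun n => set_val (g (SigSub (memn n)))); last first.
    by move=> n; apply: set_valP.
  move=> m n /val_inj /(@inj _ _ _ g) => /(_ (in_setT _) (in_setT _)) [].
  by [].
(* [f] sends [g n.+1] to [g n] and [g 0] to [a], and fixes everything else. *)
pose f x := if pselect (exists n, g n.+1 = x) is left h then g (projT1 (cid h))
  else if x == g 0 then a else x.
have [y fy] := no_surj_below a f.
have [[n gny]|ny] := pselect (exists n, g n = y).
  apply: (fy (g n.+1)); first exact: gb.
  rewrite /f; case: pselect => [h|]; last by case; exists n.
  by case: cid => m /= /ginj [->].
have [ya|ya] := pselect (y = a).
  apply: (fy (g 0)); first exact: gb.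
  rewrite /f; case: pselect => [[n /ginj]//|_]; by rewrite eqxx.
apply: (fy y).
  by rewrite lt_neqAle ale andbT; apply/eqP.
rewrite /f; case: pselect => [[n gny]|_]; first by case: ny; exists n.+1.
by case: eqP => // gny; case: ny; exists 0.
Qed.

(** If [S] embeds in no initial segment, then a recursion along [kappa] never exhausts [S]: at each
    stage some element differs from all earlier choices, and these choices inject [kappa] into
    [S]. *)
Lemma card_le_below {T : Type} (S : set T) : ~ ([set: kappa] #<= S) ->
  exists c : kappa, S #<= below c.
Proof.
elim/Pchoice: T => T in S * => nS; have [inf wf _] := kappa_card.
apply: contrapT => /forallNP nb; apply: nS.
have [x Sx] : S !=set0.
  apply/set0P; apply/negP => /eqP S0.
  have [y _] := infinite_setN0 inf.
  by apply: (nb y); rewrite S0 card_ge0.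
have [h hE] := wf_rec wf x
  (fun i h => xget x [set y | S y /\ forall j, (j < i)%O -> h j <> y]).
have hP i : S (h i) /\ forall j, (j < i)%O -> h j <> h i.
  have [y [Sy hy]] : exists y, S y /\ forall j, (j < i)%O -> h j <> y.
    apply: contrapT => /forallNP nh; apply: (nb i).
    apply: card_le_trans (card_image_le h (below i)).
    apply: subset_card_le => y Sy; have /not_andP[//|] := nh y.
    by move=> /existsNP[j /not_implyP[ji /contrapT hj]]; exists j.
  rewrite (hE i); set P := (X in xget _ X).
  have : P (xget x P).
    apply: xgetPex; exists y; split => // j ji.
    by case: (pselect _) => [/= ?|//]; apply: hy.
  by move=> [SP hP]; split=> // j ji; move: (hP j ji); case: (pselect _).
have hinj : injective h.
  move=> i j hij; apply: contrapT => /eqP; rewrite neq_lt => /orP[] ij.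
    by case: (hP j) => _ /(_ i ij); rewrite hij.
  by case: (hP i) => _ /(_ j ij); rewrite hij.
rewrite -(card_le_eql (@inj_card_eq _ _ setT h _)); last by move=> ? ? _ _ /hinj.
by apply: subset_card_le => _ [i _ <-]; case: (hP i).
Qed.

Hypothesis kappa_pow : [set: short_seq kappa] #= [set: kappa].

Definition app_seq (e : short_seq kappa) (i : kappa) : kappa :=
  if pselect (below (projT1 e) i) is left h then projT2 e (SigSub (mem_set h))
  else i.

Lemma exists_kappa_coding : inhabited (kappa_coding kappa).
Proof.
have [inf wf _] := kappa_card; have [x0 _] := infinite_setN0 inf.
have [z _ z_le] := wf_min wf (I : setT x0).
have [e enum] : exists e : kappa -> short_seq kappa, forall a h, exists j,
    projT1 (e j) = a /\ forall i, (i < a)%O -> app_seq (e j) i = h i.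
  have : [set: short_seq kappa] #<= [set: kappa].
    by move: kappa_pow; rewrite card_eq_le => /andP[].
  move=> /card_le_surj[T0|[e eE]].
    by have : [set: short_seq kappa] (existT _ z (fun i => z)) by []; rewrite T0.
  exists e => a h.
  have : [set: short_seq kappa] (existT _ a (fun i : below a => h (val i))).
    by [].
  rewrite eE => -[j _ ej]; exists j; rewrite ej; split => // i ia.
  by rewrite /app_seq /=; case: pselect.
have small := no_surj_below.
(* Diagonalisation in the manner of König: if [f] is cofinal on [below a], choose [h i] different
   from the [i]-th entry of every sequence with code at most [f i]. The code of [h] on [below a] is
   at most some [f i], a contradiction. *)
have regular (a : kappa) (f : kappa -> kappa) :
    exists b, forall i, (i < a)%O -> (f i < b)%O.
  apply: contrapT => /forallNP nf.
  have avoid i : exists y, forall j, (j <= f i)%O -> app_seq (e j) i <> y.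
    have [b fb] := exists_gt (f i).
    have [y Hy] := small b (fun j => app_seq (e j) i).
    by exists y => j jf; apply: Hy; apply: le_lt_trans fb.
  have [h hP] := choice avoid; have [j [_ jh]] := enum a h.
  have /existsNP[i /not_implyP[ia /negP]] := nf j; rewrite -leNgt => jf.
  by apply: (hP i j jf); apply: jh.
(* Pairs are coded by sequences of length [t], with the coordinates at positions [z] and [o]. *)
have [o zo] := exists_gt z; have [t ot] := exists_gt o.
apply: inhabits; apply: (@KappaCoding _ _ wf z _ exists_gt small regular
  (fun j => projT1 (e j)) (fun j => app_seq (e j)) enum
  (fun j => app_seq (e j) z) (fun j => app_seq (e j) o)).
  by move=> x; apply: z_le.
move=> x y; have [j [_ jE]] := enum t (fun i => if i == z then x else y).
exists j; rewrite !jE ?eqxx //; last exact: lt_trans ot.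
by rewrite gt_eqF.
Qed.

End Cardinal.

(** * Generic bijections *)

Section Generic.
Context {d : Order.disp_t} {kappa : orderType d} (C : kappa_coding kappa).
Implicit Types (b c i j : kappa) (s g : kappa -> kappa).

Definition agree c s s' := forall i, (i < c)%O -> s' i = s i.

Definition inj_below c s :=
  forall i j, (i < c)%O -> (j < c)%O -> s i = s j -> i = j.

Lemma agree_le {b c s s'} : (b <= c)%O -> agree c s s' -> agree b s s'.
Proof. by move=> bc ss' i ib; apply: ss'; apply: lt_le_trans bc. Qed.

Lemma agree_trans {c s s' s''} :
  agree c s s' -> agree c s' s'' -> agree c s s''.
Proof. by move=> ss' ss'' i ic; rewrite ss'' // ss'. Qed.

Lemma agree_sym {c s s'} : agree c s s' -> agree c s' s.
Proof. by move=> ss' i ic; rewrite ss'. Qed.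

Lemma inj_below_agree {c s s'} :
  agree c s s' -> inj_below c s -> inj_below c s'.
Proof. by move=> ss' si i j ic jc; rewrite !ss' //; apply: si. Qed.

(* A condition is a pair (c, s), standing for the restriction of s to the
   ordinals below c. *)
Definition cond_set := kappa -> (kappa -> kappa) -> Prop.

Definition restriction_set (D : cond_set) :=
  forall c s s', agree c s s' -> D c s -> D c s'.

Definition dense (D : cond_set) := forall c s, inj_below c s ->
  exists c' s', [/\ (c <= c')%O, agree c s s', inj_below c' s' & D c' s'].

(* Plays the role of a comeager subset of the group Sym(kappa). *)
Definition large (G : set (kappa -> kappa)) :=
  exists D : kappa -> cond_set,
    (forall i, restriction_set (D i) /\ dense (D i)) /\
    forall g, bijective g -> (forall i, exists c, D i c g) -> G g.

Lemma large_dense (D : cond_set) : restriction_set D -> dense D ->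
  large [set g | exists c, D c g].
Proof.
move=> Dr Dd; exists (fun _ => D); split=> // g _ /(_ (kzero C)) //.
Qed.

Lemma large_bijective : large [set g | bijective g].
Proof.
exists (fun _ _ _ => True); split=> // i; split=> // c s si.
by exists c, s; split.
Qed.

(** The dense sets of all the families are indexed by pairs, hence by [kappa] through [kpair]. *)
Lemma large_bigcap (G : kappa -> set (kappa -> kappa)) :
  (forall i, large (G i)) -> large (\bigcap_i G i).
Proof.
move=> /choice[D HD].
exists (fun i => D (kfst C i) (ksnd C i)); split=> [i|g gb Dg i _].
  by case: (HD (kfst C i)).
case: (HD i) => _; apply=> // j; have [k [ki kj]] := kpair C i j.
by have := Dg k; rewrite ki kj.
Qed.

Lemma largeI (G H : set (kappa -> kappa)) :
  large G -> large H -> large (G `&` H).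
Proof.
move=> lG lH.
have [i zi] := kgt C (kzero C).
(* The family is [G] at [kzero C] and [H] elsewhere; the dependent match picks the matching proof of
   largeness. *)
have [D [Dd DG]] := large_bigcap (fun i => if i == kzero C then G else H)
  (fun i => match boolP (i == kzero C) as b in alt_spec _ _ q
     return large (if q then G else H) with
     AltTrue _ => lG | AltFalse _ => lH end).
exists D; split=> // g gb Dg; split.
  by have := DG g gb Dg (kzero C) I; rewrite eqxx.
by have := DG g gb Dg i I; rewrite gt_eqF.
Qed.

Lemma sub_large {G H : set (kappa -> kappa)} : large G -> G `<=` H -> large H.
Proof. by move=> [D [Dd DG]] GH; exists D; split=> // g gb /(DG g gb)/GH. Qed.

(** This makes generic maps surjective: a value [y] not yet taken is assigned to the argument
    [c]. *)
Lemma dense_range y : dense (fun c s => exists2 x, (x < c)%O & s x = y).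
Proof.
move=> c s si.
have [[x xc sx]|ny] := pselect (exists2 x, (x < c)%O & s x = y).
  by exists c, s; split=> //; exists x.
have [b cb] := kgt C c.
(* [c'] is the immediate successor of [c], so [c] is the only new argument. *)
have [c' cc' c'min] : exists2 c', (c < c')%O &
    forall x, (c < x)%O -> (c' <= x)%O.
  exact: (wf_min (kwf C) (cb : [set x | (c < x)%O] b)).
have c'P x : (x < c')%O -> x <> c -> (x < c)%O.
  move=> xc' xc; rewrite lt_neqAle; apply/andP; split; first exact/eqP.
  by rewrite leNgt; apply/negP => /c'min; rewrite leNgt xc'.
pose s' x := if x == c then y else s x.
have s's x : (x < c)%O -> s' x = s x by move=> xc; rewrite /s' lt_eqF.
exists c', s'; split; rewrite ?ltW //; last by exists c; rewrite // /s' eqxx.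
move=> i j ic' jc'.
have [->|/eqP ic] := eqVneq i c; have [->|/eqP jc] := eqVneq j c => //.
- rewrite (s's _ (c'P _ jc' jc)) {1}/s' eqxx => yj.
  by case: ny; exists j => //; apply: c'P.
- rewrite (s's _ (c'P _ ic' ic)) {1}/s' eqxx => yj.
  by case: ny; exists i => //; apply: c'P.
- by rewrite !s's; try exact: c'P; apply: si; exact: c'P.
Qed.

(** Baire category by a recursion of length [kappa]: stage [i] extends the union of the earlier
    conditions into [D i], then puts [i] into the range. *)
Lemma large_ex (G : set (kappa -> kappa)) c0 s0 : large G -> inj_below c0 s0 ->
  exists g, [/\ bijective g, agree c0 s0 g & G g].
Proof.
move=> [D [DD DG]] s0i.
pose cond := (kappa * (kappa -> kappa))%type.
pose le_cond (p q : cond) := (p.1 <= q.1)%O /\ agree p.1 p.2 q.2.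
pose good i (h : kappa -> cond) := [set q : cond |
  [/\ inj_below q.1 q.2, le_cond (c0, s0) q,
      forall j, (j < i)%O -> le_cond (h j) q,
      exists2 c, (c <= q.1)%O & D i c q.2 &
      exists2 x, (x < q.1)%O & q.2 x = i]].
have le_cond_trans p q r : le_cond p q -> le_cond q r -> le_cond p r.
  move=> [pq1 pq2] [qr1 qr2]; split; first exact: le_trans qr1.
  exact: agree_trans pq2 (agree_le pq1 qr2).
have [h hE] := wf_rec (kwf C) (c0, s0) (fun i h => xget (c0, s0) (good i h)).
(* [good i] inspects [h] only below [i], so the padding of [wf_rec] disappears from the recursion
   equation. *)
have good_eq i h1 h2 : (forall j, (j < i)%O -> h1 j = h2 j) ->
    good i h1 = good i h2.
  move=> h12; apply/funext => q; apply/propext.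
  by split=> -[q1 q2 q3 q4 q5]; split=> // j ji;
    [rewrite -h12|rewrite h12] => //; apply: q3.
have {}hE i : h i = xget (c0, s0) (good i h).
  rewrite {1}hE; congr xget; apply: good_eq => j ji.
  by case: (pselect _).
have hP i : good i h (h i).
  elim/(well_founded_ind (kwf C)): i => i IHi.
  rewrite hE; apply: xgetPex.
  have chain j k : (j < i)%O -> (k < i)%O -> ((h j).1 <= (h k).1)%O ->
      agree (h j).1 (h j).2 (h k).2.
    move=> ji ki jk; have [jltk|kltj|->//] := ltgtP j k.
      by have [_ _ /(_ j jltk)[]] := IHi k ki.
    have [_ _ /(_ k kltj)[kj1 kj2] _ _] := IHi j ji.
    by apply: agree_sym; apply: agree_le kj2.
  (* [p] is the union of the earlier conditions, or the given condition if there are none.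
     Regularity keeps its length below [kappa]. *)
  have [p [pinj p0 ph]] : exists p : cond, [/\ inj_below p.1 p.2,
      le_cond (c0, s0) p & forall j, (j < i)%O -> le_cond (h j) p].
    have [[j ji]|noj] := pselect (exists j, (j < i)%O); last first.
      exists (c0, s0); split=> // j ji.
      by case: noj; exists j.
    have [b hb] := kregular C i (fun j => (h j).1).
    have bub : [set b | forall j, (j < i)%O -> ((h j).1 <= b)%O] b.
      by move=> k ki; apply/ltW/hb.
    (* The least upper bound is taken so that every argument below [c] is in the domain of an
       earlier condition. *)
    have [c cub cmin] := wf_min (kwf C) bub.
    have cP x : (x < c)%O -> exists k, (k < i)%O /\ (x < (h k).1)%O.
      move=> xc; apply: contrapT => /forallNP nk.
      have := cmin x; rewrite leNgt xc => /(_ _)/negP; apply=> // k ki.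
      by rewrite leNgt; apply/negP => xk; apply: (nk k).
    have /choice[k kP] : forall x, exists k,
        (x < c)%O -> (k < i)%O /\ (x < (h k).1)%O.
      move=> x; have [/cP[k kP]|xc] := pselect (x < c)%O; first by exists k.
      by exists i.
    pose s x := (h (k x)).2 x.
    have hs l : (l < i)%O -> agree (h l).1 (h l).2 s.
      move=> li x xl; rewrite /s.
      have [ki xk] := kP x (lt_le_trans xl (cub l li)).
      have [/(chain _ _ ki li)->//|/ltW/(chain _ _ li ki)->//] :=
        leP (h (k x)).1 (h l).1.
    exists (c, s); split.
    - move=> x y /= xc yc.
      have [ki xk] := kP x xc; have [li yl] := kP y yc.
      have [kl|/ltW lk] := leP (h (k x)).1 (h (k y)).1.
        have xl := lt_le_trans xk kl.
        have [linj _ _ _ _] := IHi _ li.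
        by rewrite !(hs _ li) //; apply: linj.
      have yk := lt_le_trans yl lk.
      have [kinj _ _ _ _] := IHi _ ki.
      by rewrite !(hs _ ki) //; apply: kinj.
    - have [_ h0 _ _ _] := IHi j ji.
      by apply: (le_cond_trans _ _ _ h0); split; [apply: cub|apply: hs].
    - by move=> l li; split; [apply: cub|apply: hs].
  have [c1 [s1 [pc1 ps1 s1i D1]]] := (DD i).2 p.1 p.2 pinj.
  have [c2 [s2 [c12 s12 s2i R2]]] := dense_range i c1 s1 s1i.
  have p2 : le_cond p (c2, s2).
    by split; [apply: le_trans c12|exact: agree_trans ps1 (agree_le pc1 s12)].
  exists (c2, s2); split=> //.
  - exact: le_cond_trans p0 p2.
  - by move=> j ji; apply: le_cond_trans (ph j ji) p2.
  - by exists c1 => //; apply: (DD i).1 D1.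
have chain j k : ((h j).1 <= (h k).1)%O -> agree (h j).1 (h j).2 (h k).2.
  move=> jk; have [jltk|kltj|->//] := ltgtP j k.
    by have [_ _ /(_ j jltk)[]] := hP k.
  have [_ _ /(_ k kltj)[kj1 kj2] _ _] := hP j.
  by apply: agree_sym; apply: agree_le kj2.
(* If all lengths were at most [x], the union of the conditions would map [below x] onto [kappa], as
   stage [y] has [y] in its range; this contradicts [ksmall]. *)
have total x : exists k, (x < (h k).1)%O.
  apply: contrapT => /forallNP nx.
  have hx k : ((h k).1 <= x)%O by rewrite leNgt; apply/negP/nx.
  pose f y := if pselect (exists k, (y < (h k).1)%O) is left ek
    then (h (projT1 (cid ek))).2 y else y.
  have [y fy] := ksmall C x f.
  have [_ _ _ _ [z zy hz]] := hP y.
  apply: (fy z); first exact: lt_le_trans (hx y).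
  rewrite /f; case: pselect => [ek|]; last by case; exists y.
  case: cid => k /= zk; have [yk|/ltW ky] := leP (h y).1 (h k).1.
    by rewrite (chain _ _ yk) // hz.
  by rewrite -(chain _ _ ky) // hz.
have [k kP] := choice total.
pose g x := (h (k x)).2 x.
have hg l : agree (h l).1 (h l).2 g.
  move=> x xl; rewrite /g.
  by have [/chain<-//|/ltW/chain->//] := leP (h (k x)).1 (h l).1.
have gi : injective g.
  move=> x y; have [kl|/ltW lk] := leP (h (k x)).1 (h (k y)).1.
    have xl := lt_le_trans (kP x) kl; have [linj _ _ _ _] := hP (k y).
    by rewrite !(hg (k y)) //; apply: linj.
  have yk := lt_le_trans (kP y) lk; have [kinj _ _ _ _] := hP (k x).
  by rewrite !(hg (k x)) //; apply: kinj.
have gb : bijective g.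
  rewrite -setTT_bijective; split=> //; first by move=> ? ? _ _ /gi.
  move=> y _; have [_ _ _ _ [x xy hx]] := hP y.
  by exists x => //; rewrite (hg y).
exists g; split=> //.
  (* Here [c0] serves as a stage index: every stage extends the given condition. *)
  have [_ [c0h s0h] _ _ _] := hP c0.
  exact: agree_trans s0h (agree_le c0h (hg c0)).
apply: DG => // i; have [_ _ _ [c ch Dc] _] := hP i.
by exists c; apply: (DD i).1 Dc; apply: agree_le (hg i).
Qed.

End Generic.

(** * Formulas and structures *)

Section Formulas.
Context {d : Order.disp_t} {kappa : orderType d} (C : kappa_coding kappa).
Context {L : language}.
Implicit Types (phi psi : formula L kappa) (M : Mod L kappa).
Implicit Types (s : kappa -> kappa) (b c : kappa).

Lemma sat_free {M s s' phi} : (forall v, free_vars phi v -> s v = s' v) ->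
  sat M s phi -> sat M s' phi.
Proof.
elim: phi s s' => [x y|r t|psi IHpsi|D f IHf|x psi IHpsi] s s' /= ss'.
- by rewrite !ss' //; [right|left].
- rewrite (_ : s \o t = s' \o t) //.
  by apply/funext => i /=; apply: ss'; exists i.
- by move=> nsat /IHpsi sat'; apply/nsat/sat' => v /ss'.
- by move=> sats j; apply: IHf (sats j) => v fv; apply: ss'; exists j.
- move=> [s1 s1s sat1].
  exists (fun v => if pselect (bound_vars x v) then s1 v else s' v).
    by move=> v xv; case: (pselect _).
  apply: IHpsi sat1 => v psiv; case: (pselect _) => //= xv.
  by rewrite s1s // ss'.
Qed.

Lemma sat_agree {M c s s' phi} : free_vars phi `<=` below c -> agree c s s' ->
  sat M s phi -> sat M s' phi.
Proof. by move=> phic ss'; apply: sat_free => v /phic vc; rewrite ss'. Qed.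

Definition fall (f : kappa -> formula L kappa) : formula L kappa :=
  @fand _ _ _ setT (fun j => f (set_val j)).

Lemma sat_fall M s f : sat M s (fall f) <-> forall j, sat M s (f j).
Proof. by split=> [fs j|fs j]; [apply: (fs (SigSub (in_setT j)))|apply: fs]. Qed.

Lemma free_fall f (D : set kappa) : (forall j, free_vars (f j) `<=` D) ->
  free_vars (fall f) `<=` D.
Proof. by move=> fD v [j _ /fD]. Qed.

Lemma qrank_fall f a :
  (forall j, ole (qrank (f j)) a) -> ole (qrank (fall f)) a.
Proof. by move=> fa j; apply: fa. Qed.

Definition ftrue : formula L kappa :=
  fand (fun _ : set0 => feq _ (kzero C) (kzero C)).

Lemma sat_ftrue M s : sat M s ftrue.
Proof. by move=> [j jP]; have := set_mem jP. Qed.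

Lemma free_ftrue : free_vars ftrue = set0.
Proof. by apply/seteqP; split=> // v [[j jP]]; have := set_mem jP. Qed.

Definition fif (P : Prop) phi := if pselect P then phi else ftrue.

Lemma sat_fif M s P phi : sat M s (fif P phi) <-> (P -> sat M s phi).
Proof.
rewrite /fif; case: (pselect P) => HP /=; first by split=> // /(_ HP).
by split=> // _; apply: sat_ftrue.
Qed.

Lemma free_fif P phi (D : set kappa) : (P -> free_vars phi `<=` D) ->
  free_vars (fif P phi) `<=` D.
Proof.
rewrite /fif; case: (pselect P) => [HP|nP] PD; first exact: PD.
by change (free_vars ftrue `<=` D); rewrite free_ftrue; apply: sub0set.
Qed.

Definition finj c := fall (fun j =>
  fif [/\ (kfst C j < c)%O, (ksnd C j < c)%O & kfst C j <> ksnd C j]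
      (fnot (feq _ (kfst C j) (ksnd C j)))).

Lemma sat_finj M s c : sat M s (finj c) <-> inj_below c s.
Proof.
split=> [/sat_fall sinj i j ic jc sij|sinj].
  apply: contrapT => nij; have [k [ki kj]] := kpair C i j.
  by have /sat_fif := sinj k; rewrite ki kj /=; apply.
by apply/sat_fall => j; apply/sat_fif => -[jc jc' nj] /sinj; auto.
Qed.

Lemma free_finj c : free_vars (finj c) `<=` below c.
Proof. by apply: free_fall => j; apply: free_fif => -[ic jc _] v /= [] ->. Qed.

Lemma sat_fex M s x psi : sat M s (fex x psi) =
  exists2 s', (forall v, ~ bound_vars x v -> s' v = s v) & sat M s' psi.
Proof. by []. Qed.

(* Quantifies the variables v with c <= v < b; if b <= c it binds at most v_c,
   which does not occur in psi when free_vars psi `<=` below b. *)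
Definition fext c b psi : formula L kappa :=
  fex (existT _ b (fun i : below b => Order.max (set_val i) c))
    (fall (fun j => if j == kzero C then finj b else psi)).

Lemma sat_fext M s c b psi : free_vars psi `<=` below b ->
  sat M s (fext c b psi) <->
  exists s', [/\ agree c s s', inj_below b s' & sat M s' psi].
Proof.
move=> psib; rewrite sat_fex.
split=> [[s' s's /sat_fall sat']|[s1 [ss1 inj1 sat1]]].
  exists s'; split.
  - move=> v vc; apply: s's => -[i _ /= iv].
    by move: vc; rewrite -iv gt_max ltxx andbF.
  - by have := sat' (kzero C); rewrite eqxx sat_finj.
  (* The conjunction inside [fext] has [finj b] at index [kzero C] and [psi] at every other
     index. *)
  - by have [j zj] := kgt C (kzero C); have := sat' j; rewrite gt_eqF.
set x := existT _ b _.
(* [s1] may differ from [s] at variables from [b] on that are not quantified, so it is kept only at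
   the quantified ones. *)
pose s' v := if pselect (bound_vars x v) then s1 v else s v.
have s's1 : agree b s1 s'.
  move=> v vb; rewrite /s'; case: (pselect _) => //= xv.
  rewrite ss1 // ltNge; apply/negP => cv; apply: xv.
  by exists (SigSub (mem_set (vb : below b v))) => //=; apply: max_l.
exists s'; first by move=> v xv; rewrite /s'; case: (pselect _).
apply/sat_fall => j; case: eqVneq => _.
  by apply/sat_finj; apply: inj_below_agree inj1.
exact: (sat_agree psib s's1 sat1).
Qed.

Lemma free_fext c b psi : free_vars psi `<=` below b ->
  free_vars (fext c b psi) `<=` below c.
Proof.
move=> psib v [psiv xv]; rewrite /below /= ltNge; apply/negP => cv; apply: xv.
have vb : below b v.
  suff sub : free_vars (fall (fun j => if j == kzero C then finj b else psi))
      `<=` below b by apply: sub.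
  by apply: free_fall => j; case: eqVneq => // _; apply: free_finj.
by exists (SigSub (mem_set vb)) => //=; apply: max_l.
Qed.

(** Since [finj b] is quantifier-free, the conjunction has at most the rank of [psi], and the block
    of quantifiers counts once whatever its length. *)
Lemma qrank_fext c b psi a : olt (qrank psi) a -> ole (qrank (fext c b psi)) a.
Proof.
move=> psia.
suff sub : ole (qrank (fall (fun j => if j == kzero C then finj b else psi)))
  (qrank psi) by apply: ole_trans psia; exact: sub.
apply: qrank_fall => j.
case: eqVneq => _; last exact: ole_refl.
apply: (ole_trans _ ozero) => //; apply: qrank_fall => i.
by rewrite /fif; case: (pselect _) => //= _ k.
Qed.

Definition pull (g : kappa -> kappa) M : Mod L kappa := fun r t => M r (g \o t).

Lemma isomorphic_sym (M N : Mod L kappa) : isomorphic M N -> isomorphic N M.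
Proof.
move=> [f [g fK gK] fMN]; exists g; first by exists f.
move=> r t; rewrite fMN (_ : f \o (g \o t) = t) //.
by apply/funext => i /=; rewrite gK.
Qed.

Lemma isomorphic_pull g M : bijective g -> isomorphic (pull g M) M.
Proof. by move=> gb; exists g. Qed.

(** These are the coordinates of [Mod L kappa] seen as a power of 2. *)
Definition fact := {r : L & 'I_(arity r) -> kappa}.
Definition holds M (x : fact) := M (projT1 x) (projT2 x).

Lemma finite_bounded n (t : 'I_n -> kappa) : exists b, forall i, (t i < b)%O.
Proof.
elim: n t => [|n IHn] t; first by exists (kzero C) => -[].
have [b tb] := IHn (fun i => t (lift ord0 i)).
have [c0 tc0] := kgt C (t ord0).
exists (Order.max b c0) => i; rewrite lt_max.
by case: (unliftP ord0 i) => [j ->|->]; rewrite ?tb ?tc0 ?orbT.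
Qed.

(** Induction on the length: bounds for the tails, one for each first entry below [b], are
    themselves bounded by regularity. *)
Lemma tuples_bounded n b (f : ('I_n -> kappa) -> kappa) :
  exists c, forall t, (forall i, (t i < b)%O) -> (f t < c)%O.
Proof.
elim: n f => [|n IHn] f.
  have [c fc] := kgt C (f (fun _ => kzero C)); exists c => t _.
  by rewrite (_ : t = fun _ => kzero C) //; apply/funext => -[].
pose cons x (t : 'I_n -> kappa) i := if unlift ord0 i is Some j then t j else x.
have /choice[h hP] := fun x => IHn (fun t => f (cons x t)).
have [c hc] := kregular C b h.
exists c => t tb; apply: lt_trans (hc (t ord0) (tb _)).
rewrite (_ : t = cons (t ord0) (fun i => t (lift ord0 i))).
  by rewrite /cons unlift_none; apply: hP => i; apply: tb.
apply/funext => i; rewrite /cons.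
by case: (unliftP ord0 i) => [j ->|->]; rewrite ?liftK ?unlift_none.
Qed.

Lemma small_bounded {T : Type} (S : set T) (f : T -> kappa) :
  (exists c : kappa, S #<= below c) ->
  exists b, forall x, S x -> (f x < b)%O.
Proof.
move=> [c /card_le_surj[->|[g ->]]]; first by exists (kzero C).
have [b hb] := kregular C c (f \o g).
by exists b => _ [i ic <-]; apply: hb.
Qed.

(** Tuples are coded as lists by iterated pairing: entry [i] is the head of the [i]-th tail. *)
Lemma tuple_code n (t : 'I_n -> kappa) :
  exists j, forall i : 'I_n, kfst C (iter i (ksnd C) j) = t i.
Proof.
elim: n t => [|n IHn] t; first by exists (kzero C) => -[].
have [j jt] := IHn (fun i => t (lift ord0 i)).
have [k [kt kj]] := kpair C (t ord0) j.
exists k => i; case: (unliftP ord0 i) => [{}i ->|->] //.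
by rewrite lift0 iterSr kj jt.
Qed.

(** A code pairs an index of the symbol with a tuple code, read up to the arity of that symbol;
    [None] occurs only for the empty language. *)
Lemma fact_code : [set: L] #<= [set: kappa] ->
  exists dec : kappa -> option fact, forall x, exists j, dec j = Some x.
Proof.
move=> /card_le_surj[L0|[e eE]].
  by exists (fun _ => None) => -[r t]; have : [set: L] r by []; rewrite L0.
exists (fun j => Some (existT _ (e (kfst C j))
  (fun i : 'I__ => kfst C (iter i (ksnd C) (ksnd C j))))) => -[r t].
have : [set: L] r by []; rewrite eE => -[l _ lr].
have [k kt] := tuple_code _ t; have [j [jl jk]] := kpair C l k.
exists j; rewrite jl jk lr; congr (Some (existT _ _ _)).
exact/funext.
Qed.

End Formulas.

(** * The Vaught transform *)

Scheme Sigma0_mind := Minimality for Sigma0 Sort Prop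
  with Pi0_mind := Minimality for Pi0 Sort Prop.

Section VaughtTransform.
Context {d : Order.disp_t} {kappa : orderType d}.
Hypothesis kappa_card : infinite_cardinal kappa.
Context (C : kappa_coding kappa) {L : language}.
Context {dec : kappa -> option (@fact _ kappa L)}.
Hypothesis decP : forall x, exists j, dec j = Some x.
Implicit Types (M : Mod L kappa) (s g : kappa -> kappa) (a : ord kappa).

Definition same_below (b : kappa) M M' := forall j x, (j < b)%O ->
  dec j = Some x -> (holds M' x <-> holds M x).

(** A basic set constrains fewer than [kappa] symbols on a bounded domain, so by regularity the
    codes of the facts involved are bounded. *)
Lemma basic_same_below (N : set (Mod L kappa)) M : Mod_basic N -> N M ->
  exists b, forall M', same_below b M M' -> N M'.
Proof.
move=> [S [D [Q [[_ smallS] [b Db] ->]]]] QM.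
have /choice[code codeP] := decP.
have /choice[h hP] := fun r : L =>
  tuples_bounded C _ b (fun t => code (existT _ r t)).
have [c hc] := small_bounded C S h (card_le_below kappa_card S smallS).
exists c => M' MM' r t; rewrite QM; symmetry.
pose x : fact := existT _ (set_val r) (set_val \o t).
apply: (MM' (code x) x _ (codeP x)).
apply: lt_trans (hc _ (set_valP r)); apply: (hP _ (set_val \o t)) => i.
exact: (Db _ (set_valP (t i))).
Qed.

(** The basic sets generate the topology as a subbase, so the maximum of finitely many bounds is
    taken. *)
Lemma open_same_below (U : set (Mod L kappa)) M : open U -> U M ->
  exists b, forall M', same_below b M M' -> U M'.
Proof.
move=> [D' sD <-] [_ /[dup] /sD [F sF <-] DF FM].
have [b bP] : exists b : kappa, forall N, N \in finmap.enum_fset F ->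
    forall M', same_below b M M' -> N M'.
  have {DF} : forall N, N \in finmap.enum_fset F -> Mod_basic N /\ N M.
    by move=> N NF; split; [exact: (set_mem (sF N NF))|exact: FM].
  elim: (finmap.enum_fset F) => [|N l IHl] lP; first by exists (kzero C).
  have [b bP] :=
    IHl (fun N Nl => lP N (mem_behead (Nl : N \in behead (_ :: l)))).
  have [NB NM] := lP N (mem_head _ _).
  have [c cP] := basic_same_below N M NB NM.
  exists (Order.max b c) => N'; rewrite inE => /orP[/eqP ->|N'l] M' MM'.
    by apply: cP => j x jc; apply: MM'; rewrite lt_max jc orbT.
  by apply: (bP N' N'l) => j x jb; apply: MM'; rewrite lt_max jb.
exists b => M' MM'; eexists; first exact: DF.
by move=> N NF; apply: (bP N NF).
Qed.

Context {K : set (Mod L kappa)}.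

(* The k-th short sequence codes the basic open set of the structures in which,
   among the facts dec j with j < klen C k, exactly those with
   kap C k j = kzero C hold. *)
Definition nbhd k := [set M | forall j x, (j < klen C k)%O -> dec j = Some x ->
  (holds M x <-> kap C k j = kzero C)].

Definition literal k j : formula L kappa :=
  if dec j is Some x then
    if kap C k j == kzero C then Defs.frel (projT2 x)
    else fnot (Defs.frel (projT2 x))
  else ftrue C.

Definition code_vars k c := forall j x, (j < klen C k)%O -> dec j = Some x ->
  forall i, (projT2 x i < c)%O.

Definition fnbhd k := fall (fun j => fif C (j < klen C k)%O (literal k j)).

Lemma sat_fnbhd M g k : sat M g (fnbhd k) <-> nbhd k (pull g M).
Proof.
split=> [/sat_fall sat' j x jk jx|Ng].
  have /sat_fif := sat' j; rewrite /literal jx => /(_ jk).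
  case: eqVneq => [kz|/eqP kz] /= Mx; first by split=> // _; exact: Mx.
  by split=> // Mx'; case: Mx.
apply/sat_fall => j; apply/sat_fif => jk; rewrite /literal.
case jx: (dec j) => [x|]; last exact: sat_ftrue.
have := Ng j x jk jx; case: eqVneq => [kz|/eqP kz] Hx; first exact: (Hx.2 kz).
by move=> Mx; apply: kz; apply: Hx.1.
Qed.

Lemma free_fnbhd k c : code_vars k c -> free_vars (fnbhd k) `<=` below c.
Proof.
move=> kc; apply: free_fall => j; apply: free_fif => jk; rewrite /literal.
case jx: (dec j) => [x|]; last by rewrite free_ftrue.
by case: eqVneq => _ _ [i _ <-]; apply: kc jx i.
Qed.

Lemma qrank_fnbhd k : ole (qrank (fnbhd k)) ozero.
Proof.
apply: qrank_fall => j; rewrite /fif; case: (pselect _) => [jk|njk] //=.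
by rewrite /literal; case: (dec j) => [x|//]; case: eqVneq.
Qed.

(** The formulas do not depend on [M], while the large set may. Quantifying over points of [subsp K]
    leaves the pullbacks outside [K] unconstrained. *)
Definition vaught a (B : set (subsp K)) :=
  exists phi : kappa -> kappa -> formula L kappa,
  [/\ forall k c, free_vars (phi k c) `<=` below c,
      forall k c, olt (qrank (phi k c)) a &
      forall M, large [set g | forall x : subsp K, set_val x = pull g M ->
        (B x <-> exists k c, sat M g (phi k c))]].

(** An open set is a union of sets [nbhd k], and whether a pullback along [g] lies in [nbhd k] is a
    quantifier-free condition on [g]; it works for every bijection. *)
Lemma vaught_open a B : ole oone a -> open B -> vaught a B.
Proof.
move=> a1 [U Uo <-].
pose good k c := (forall M, nbhd k M -> K M -> U M) /\ code_vars k c.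
(* Codes that are not good receive a false formula, which adds nothing to the disjunction. *)
exists (fun k c => if pselect (good k c) then fnbhd k else fnot (ftrue C)).
split.
- move=> k c; case: (pselect _) => [[kU kc]|?]; first exact: free_fnbhd.
  by change (free_vars (ftrue C (L := L)) `<=` below c); rewrite free_ftrue.
- move=> k c; apply: ole_trans a1.
  by case: (pselect _) => [kc|?]; [exact: qrank_fnbhd|case].
- move=> M; apply: (sub_large (large_bijective)) => g gb x xg.
  split=> [Ux|[k [c]]]; last first.
    case: (pselect _) => [[kU kc] /sat_fnbhd|? nT]; last first.
      by case: nT; apply: sat_ftrue.
    by rewrite -xg => /kU; apply; apply: set_valP.
  have [b bP] := open_same_below U _ Uo Ux.
  (* [k] will code the diagram of [x] on the facts coded below [b]; the entry [z], distinct from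
     [kzero C], marks the facts that fail. *)
  have [z zP] := kgt C (kzero C).
  have [k [kb kP]] := kenum C b (fun j =>
    if pselect (exists2 y, dec j = Some y & holds (set_val x) y)
    then kzero C else z).
  have kE j y : (j < klen C k)%O -> dec j = Some y ->
      (holds (set_val x) y <-> kap C k j = kzero C).
    rewrite kb => jb jy; rewrite kP //.
    case: (pselect _) => [[y' ]|ny] /=; first by rewrite jy => -[<-].
    split=> [hy|z0]; first by case: ny; exists y.
    by move: zP; rewrite z0 ltxx.
  have [c kc] : exists c, code_vars k c.
    have /choice[h hP] : forall j, exists c : kappa, forall y,
        dec j = Some y -> forall i, (projT2 y i < c)%O.
      move=> j; case: (dec j) => [[r t]|]; last by exists z.
      by have [c tc] := finite_bounded C _ t; exists c => _ [<-].
    have [c hc] := kregular C (klen C k) h; exists c => j y jk jy i.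
    by apply: lt_trans (hc j jk); apply: hP.
  exists k, c; case: (pselect _) => [?|[]]; first by apply/sat_fnbhd; rewrite -xg.
  split=> // M' kM' _; apply: bP => j y jb jy.
  have jk : (j < klen C k)%O by rewrite kb.
  exact: iff_trans (kM' j y jk jy) (iff_sym (kE j y jk jy)).
Qed.

(** A generic [g] meets, for each [i], a condition that decides [B i], so its pullback avoids [B i]
    exactly when some restriction of [g] forces this. *)
Lemma vaught_bigcup a (b : kappa -> ord kappa) (B : kappa -> set (subsp K)) :
  (forall i, olt (b i) a) -> (forall i, vaught (b i) (B i)) ->
  vaught a (\bigcup_i ~` B i).
Proof.
move=> ba /choice[phi phiP].
have phic i k c : free_vars (phi i k c) `<=` below c by case: (phiP i).
(* M |= theta i c (s) says that no condition extending the restriction of s to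
   c forces the pullback of M into B i. *)
pose theta i c := fall (fun m =>
  fnot (fext C c (ksnd C m) (phi i (kfst C m) (ksnd C m)))).
have satP M s i c : sat M s (theta i c) <-> forall k e s',
    agree c s s' -> inj_below e s' -> ~ sat M s' (phi i k e).
  split=> [/sat_fall tm k e s' ss' s'i sat'|tm].
    have [m [mk me]] := kpair C k e; have := tm m; rewrite mk me; apply.
    by apply/sat_fext; first exact: phic; exists s'.
  apply/sat_fall => m /sat_fext[]; first exact: phic.
  by move=> s' [ss' s'i]; apply: tm ss' s'i.
have freeT i c : free_vars (theta i c) `<=` below c.
  by apply: free_fall => m; apply: free_fext.
exists theta; split=> //.
  move=> i c; apply: ole_trans (ba i).
  suff : ole (qrank (theta i c)) (b i) by [].
  by apply: qrank_fall => m; apply: qrank_fext; case: (phiP i).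
move=> M.
(* [E i] consists of the conditions deciding [B i]: they force the pullback out of [B i] or already
   satisfy one of its formulas. *)
pose E i c s := sat M s (theta i c) \/
  exists k e, (e <= c)%O /\ sat M s (phi i k e).
have Er i : restriction_set (E i).
  move=> c s s' ss' [sT|[k [e [ec se]]]].
    by left; apply: sat_agree ss' sT.
  by right; exists k, e; split=> //; apply: sat_agree (agree_le ec ss') se.
have Ed i : dense (E i).
  move=> c s si; have [sT|] := pselect (sat M s (theta i c)).
    by exists c, s; split=> //; left.
  rewrite satP => /existsNP[k /existsNP[e /existsNP[s' /not_implyP[ss']]]].
  move=> /not_implyP[s'i /contrapT se].
  have [ec|/ltW ce] := leP e c.
    exists c, s'; split=> //; first exact: inj_below_agree si.
    by right; exists k, e.
  by exists e, s'; split=> //; right; exists k, e.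
have phiL i : large [set g | forall x : subsp K, set_val x = pull g M ->
    (B i x <-> exists k c, sat M g (phi i k c))] by case: (phiP i).
apply: (sub_large (largeI C _ _ (large_bijective)
  (largeI C _ _ (large_bigcap C _ (fun i => large_dense C _ (Er i) (Ed i)))
    (large_bigcap C _ phiL)))).
move=> g [gb [gE gB]] x xg; split=> [[i _ nBx]|[i [c]]].
  have [c [sT|[k [e [_ se]]]]] := gE i I; first by exists i, c.
  by case: nBx; apply/(gB i I x xg); exists k, e.
rewrite satP => sT; exists i => // Bx.
have /(gB i I x xg)[k [e se]] := Bx.
(* [g] extends its own restriction to [c], so what that restriction forces applies to [g] itself. *)
by apply: (sT k e g) => // ? ? _ _; apply: bij_inj.
Qed.

(** Simultaneous induction on both classes, where a [Pi0] set is represented by the transform of its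
    complement. *)
Lemma vaught_Sigma0 a (B : set (subsp K)) : Sigma0 a B -> vaught a B.
Proof.
apply: (@Sigma0_mind _ _ vaught (fun a B => vaught a (~` B))).
- by move=> {}a {}B [_ a1]; apply: vaught_open.
- move=> {}a b {}B _ b1 _ bB.
  rewrite (_ : \bigcup_i B i = \bigcup_i ~` (~` B i)); last first.
    by apply: eq_bigcupr => i _; rewrite setCK.
  by apply: (vaught_bigcup _ b) => // i; case: (b1 i).
- by move=> {}a {}B _ aB; rewrite setCK.
Qed.

End VaughtTransform.

(** * Borel sets and definable sets *)

Section Borel.
Context {kappa : Type} {T : topologicalType}.
Implicit Types (A : set T).

Lemma kplus_borelC A : kplus_borel kappa A -> kplus_borel kappa (~` A).
Proof. by move=> bA F /[dup] FF [[FC _] _]; apply: FC; apply: bA. Qed.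

Lemma kplus_borel_bigcup (D : set kappa) (B : kappa -> set T) :
  (forall i, D i -> kplus_borel kappa (B i)) ->
  kplus_borel kappa (\bigcup_(i in D) B i).
Proof. by move=> bB F /[dup] FF [[_ FU] _]; apply: FU => i /bB; apply. Qed.

Lemma open_kplus_borel A : open A -> kplus_borel kappa A.
Proof. by move=> oA F [_]; apply. Qed.

Lemma borel_levelC A (a : ord kappa) : borel_level A a -> borel_level (~` A) a.
Proof.
move=> [a1 [sA|pA]]; split=> //; first by right; constructor.
by left; case: pA => {a1}a A' sA'; rewrite setCK.
Qed.

(** The sets having a level form a [kplus_algebra]: a union is placed at the supremum of the
    successors of the levels of its members. *)
Lemma kplus_borel_level A : inhabited kappa ->
  kplus_borel kappa A -> exists a : ord kappa, borel_level A a.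
Proof.
move=> [k0]; have oo : oeq (kappa := kappa) oone oone by split; apply: ole_refl.
have openL B : open B -> exists a : ord kappa, borel_level B a.
  by exists oone; split; [exact: ole_refl|left; apply: Sigma0_one].
have step (a : ord kappa) B : ole oone a -> Pi0 a B -> Sigma0 (osucc a) B.
  move=> a1 aB; rewrite (_ : B = \bigcup_(i : kappa) B); last first.
    by apply/seteqP; split=> x; [exists k0|case].
  apply: (Sigma0_union (b := fun _ => a)) => // _.
  by split=> //; apply: ole_refl.
move=> /(_ [set B | exists a : ord kappa, borel_level B a]); apply.
split; last exact: openL.
split=> [B [a /borel_levelC]|D B DB]; first by exists a.
have [[i0 Di0]|D0] := pselect (D !=set0); last first.
  rewrite (_ : bigcup _ _ = set0); first by apply: openL; apply: open0.
  by apply/seteqP; split=> // x [i Di]; case: D0; exists i.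
(* Indices outside [D] repeat a member of the family, so that the union runs over all of [kappa]. *)
pose B' i := if pselect (D i) then B i else B i0.
have -> : \bigcup_(i in D) B i = \bigcup_i B' i.
  apply/seteqP; split=> x [i]; rewrite /B' => Di.
    by exists i => //; case: (pselect _).
  by case: (pselect _) => [D'i|nDi] xB; [exists i|exists i0].
have : forall i : kappa, exists a : ord kappa, ole oone a /\ Pi0 a (B' i).
  move=> i; have [a [a1 [sB|pB]]] : exists a : ord kappa, borel_level (B' i) a.
  - by rewrite /B'; case: (pselect _) => Di; apply: DB.
  (* The complement is [Pi0 a], hence [Sigma0 (osucc a)], so the set itself is [Pi0 (osucc a)]. *)
  - exists (osucc a); split; first exact: ole_trans a1 (ole_succ a).
    by rewrite -(setCK (B' i)); constructor; apply: step => //; constructor.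
  - by exists a.
move=> /choice[b bP].
have a2 : ole otwo (osup (fun i : [set: kappa] => osucc (b (set_val i)))).
  by exists (SigSub (in_setT k0)); case: (bP k0).
exists (osup (fun i : [set: kappa] => osucc (b (set_val i)))); split.
  exact: ole_trans (ole_succ _) a2.
left; apply: (Sigma0_union (b := b)) => // i; last by case: (bP i).
split; first by case: (bP i).
by exists (SigSub (in_setT i)); apply: ole_refl.
Qed.

(** The maximum with [oone] accounts for clopen sets, whose rank is [ozero] although levels start at
    [oone]. For other sets a level exists, so [xget] returns a least one. *)
Lemma borel_level_rkB A : inhabited kappa -> kplus_borel kappa A ->
  exists a : ord kappa, borel_level A a /\ ole a (omax (rkB kappa A) oone).
Proof.
move=> k0 bA; rewrite /rkB; case: asboolP => [[oA _]|_].
  exists oone; rewrite /omax asboolT //; split; last exact: ole_refl.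
  split; first exact: ole_refl.
  by left; apply: Sigma0_one => //; split; apply: ole_refl.
have [a0 /ex_is_least aL] := kplus_borel_level A k0 bA.
have [aA _] := xgetPex ozero aL.
exists (xget ozero [set a | is_least (borel_level A) a]); split=> //.
by rewrite /omax; case: asboolP => // _; apply: ole_refl.
Qed.

End Borel.

(** * Sets defined by sentences are invariant and Borel *)

Section Sentences.
Context {d : Order.disp_t} {kappa : orderType d} {L : language}.
Implicit Types (phi psi sigma : formula L kappa) (M N : Mod L kappa).

Lemma sentence_models sigma M s : sentence sigma ->
  models M sigma <-> sat M s sigma.
Proof.
move=> s0; split=> [|sat' s']; first exact.
by apply: sat_free sat' => v; rewrite s0.
Qed.

Lemma sat_isomorphic (f : kappa -> kappa) M N s phi : bijective f ->
  (forall (r : L) (t : 'I_(arity r) -> kappa), M r t <-> N r (f \o t)) ->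
  sat M s phi <-> sat N (f \o s) phi.
Proof.
move=> [g fK gK] fMN.
elim: phi s => [x y|r t|psi IHpsi|D h IHh|x psi IHpsi] s /=.
- by split=> [->//|/(can_inj fK)].
- exact: fMN.
- by rewrite IHpsi.
- by split=> sat' j; apply/IHh/sat'.
- split=> -[s' s's sat'].
    by exists (f \o s') => [v /s's /= ->//|]; apply/IHpsi.
  exists (g \o s') => [v /s's /= ->|]; first by rewrite /= fK.
  by apply/IHpsi; rewrite (_ : f \o _ = s') //; apply/funext => v /=; rewrite gK.
Qed.

Lemma Mod_of_invariant sigma : sentence sigma -> iso_invariant (Mod_of sigma).
Proof.
move=> s0 M N [f fb fMN] Msigma.
apply/(sentence_models _ _ (f \o id) s0)/(sat_isomorphic f M N) => //.
Qed.

Lemma open_Mod_basic (N : set (Mod L kappa)) : Mod_basic N -> open N.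
Proof.
move=> NB; exists [set N]; last by rewrite bigcup_set1.
by move=> _ ->; apply: finI_from1.
Qed.

Hypothesis kappa_card : infinite_cardinal kappa.
Context (C : kappa_coding kappa).

Lemma open_frel (r : L) (t : 'I_(arity r) -> kappa) :
  open [set M : Mod L kappa | M r t].
Proof.
(* The set is the union of the basic neighbourhoods given by the substructures on the finite set
   [range t], in the language with the single symbol [r]. *)
pose Q (M : Mod L kappa) : structure (sublanguage [set r]) (range t) :=
  fun q u => M (set_val q) (set_val \o u).
rewrite (_ : mkset _ = \bigcup_(M in [set M : Mod L kappa | M r t])
    [set N | is_substructure (Q M) (reduct [set r] N)]).
  apply: bigcup_open => M _; apply: open_Mod_basic.
  exists [set r], (range t), (Q M); split=> //.
    have [inf _ _] := kappa_card; have [x _] := infinite_setN0 inf.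
    split; last by move=> /card_le_finite finr; apply: inf; apply: finr.
    by rewrite (card_le_eql (eq_card1 r x)) card_leT.
  have [b tb] := finite_bounded C _ t.
  by exists b => _ [i _ <-]; apply: tb.
apply/seteqP; split=> [M Mr|N [M Mr QN]]; first by exists M.
pose r' : sublanguage [set r] := SigSub (mem_set (erefl r : [set r] r)).
pose u : 'I_(arity r') -> range t := fun i =>
  SigSub (mem_set (ex_intro2 _ _ i I erefl : range t (t i))).
exact: (QN r' u).1.
Qed.

(** Induction on the formula with the assignment fixed. An existential quantifier becomes a union
    over [kappa], as the values of fewer than [kappa] variables are coded by [kenum]. *)
Lemma kplus_borel_sat (K : set (Mod L kappa)) phi s :
  kplus_borel kappa (trace K [set M | sat M s phi]).
Proof.
have open_cst (P : Prop) : open (trace K [set M | P]).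
  have [HP|nP] := pselect P.
    by rewrite (_ : trace _ _ = setT); [apply: openT|apply/seteqP; split].
  by rewrite (_ : trace _ _ = set0); [apply: open0|apply/seteqP; split=> // x /nP].
elim: phi s => [x y|r t|psi IHpsi|D h IHh|x psi IHpsi] s /=.
- exact: (open_kplus_borel _ (open_cst (s x = s y))).
- apply: open_kplus_borel; exists [set M : Mod L kappa | M r (s \o t)] => //.
  exact: open_frel.
- exact: (kplus_borelC _ (IHpsi s)).
- pose B i : set (subsp K) := if pselect (D i) is left Di
    then ~` trace K [set M | sat M s (h (SigSub (mem_set Di)))] else set0.
  rewrite (_ : trace _ _ = ~` \bigcup_(i in D) B i).
    apply: kplus_borelC; apply: kplus_borel_bigcup => i Di.
    by rewrite /B; case: (pselect _) => // D'i; apply: kplus_borelC; apply: IHh.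
  apply/seteqP; split=> M /= sat'.
    by move=> [i Di]; rewrite /B; case: (pselect _) => // D'i; apply.
  move=> [i iD]; apply: contrapT => nsat; apply: sat'.
  exists i; rewrite /B; first exact: set_mem iD.
  case: (pselect _) => [Di|/(_ (set_mem iD))//].
  by rewrite (_ : mem_set Di = iD) //; apply: bool_irrelevance.
- case: x => a x.
  have [z _] : [set: kappa] !=set0 by apply: infinite_setN0; case: kappa_card.
  (* [x] may list a variable repeatedly; [p v] is one position of [v], and the coded sequence gives
     [v] its entry there. *)
  have /choice[p pP] : forall v, exists i : kappa, bound_vars (existT _ a x) v ->
      exists ia : below a i, x (SigSub (mem_set ia)) = v.
    move=> v; have [[i _ <-]|nv] := pselect (bound_vars (existT _ a x) v).
      exists (set_val i) => _; exists (set_valP i).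
      by congr (x _); apply: val_inj.
    by exists z.
  pose upd k v :=
    if pselect (bound_vars (existT _ a x) v) then kap C k (p v) else s v.
  rewrite (_ : trace _ _ = \bigcup_k trace K [set M | sat M (upd k) psi]).
    by apply: kplus_borel_bigcup => k _; apply: IHpsi.
  apply/seteqP; split=> M /= [].
    move=> s' s's sat'.
    have [k [ka kP]] := kenum C a (fun i =>
      if pselect (below a i) is left ia then s' (x (SigSub (mem_set ia))) else i).
    exists k => //=; rewrite (_ : upd k = s') //.
    apply/funext => v; rewrite /upd; case: (pselect _) => [xv|/s's//].
    have [ia xia] := pP v xv; rewrite kP //.
    case: (pselect _) => // ia'.
    by rewrite -[in RHS]xia (Prop_irrelevance ia' ia).
  move=> k _ /= satk; exists (upd k) => // v xv.
  by rewrite /upd; case: (pselect _).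
Qed.

End Sentences.

(** * Invariant sets with a Vaught transform are defined by sentences *)

Section InvariantSets.
Context {d : Order.disp_t} {kappa : orderType d}.
Context (C : kappa_coding kappa) {L : language}.
Implicit Types (M : Mod L kappa) (A K : set (Mod L kappa)).

Lemma vaught_sentence (a : ord kappa) A K : iso_invariant K ->
  iso_invariant A -> A `<=` K -> vaught a (trace K A) ->
  exists sigma : formula L kappa,
    [/\ sentence sigma, A = Mod_of sigma `&` K & ole (qrank sigma) a].
Proof.
move=> Kinv Ainv AK [phi [phic phia phiA]].
(* Starting at [kzero C], the block binds all variables below [ksnd C m], leaving none free. *)
pose psi m := fext C (kzero C) (ksnd C m) (phi (kfst C m) (ksnd C m)).
pose sigma := fnot (fall (fun m => fnot (psi m))).
have sigma0 : sentence sigma.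
  apply/seteqP; split=> // v sv.
  have : free_vars sigma `<=` below (kzero C).
    apply: (free_fall (fun m => fnot (psi m))) => m.
    by apply: free_fext; apply: phic.
  by move=> /(_ v sv); rewrite /below /= ltNge kzero_le.
have sat_sigma M s : sat M s sigma <-> exists k c s',
    inj_below c s' /\ sat M s' (phi k c).
  have -> : sat M s sigma = ~ sat M s (fall (fun m => fnot (psi m))) by [].
  rewrite sat_fall; split=> [nsat|[k [c [s' [s'i sat']]]] nsat].
    apply: contrapT => nex; apply: nsat => m.
    move=> /sat_fext[]; first exact: phic.
    by move=> s' [_ s'i sat']; apply: nex; exists (kfst C m), (ksnd C m), s'.
  have [m [mk mc]] := kpair C k c; apply: (nsat m); rewrite /psi mk mc.
  apply/sat_fext; first exact: phic.
  by exists s'; split=> // i; rewrite ltNge kzero_le.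
have pullA M g : bijective g -> A (pull g M) <-> A M.
  move=> gb; have gM := isomorphic_pull g M gb.
  by split; apply: Ainv => //; apply: isomorphic_sym.
(* Every condition extends to a generic bijection, and by invariance the truth of [A M] can be read
   off from any of these. *)
have generic M c s : K M -> inj_below c s -> exists g,
    [/\ bijective g, agree c s g & (A M <-> exists k c, sat M g (phi k c))].
  move=> KM si; have [g [gb sg gA]] := large_ex C _ c s (phiA M) si.
  exists g; split=> //; rewrite -(pullA M g gb).
  have Kg : K (pull g M).
    by apply: Kinv KM; apply/isomorphic_sym/isomorphic_pull.
  exact: (gA (SigSub (mem_set Kg)) erefl).
exists sigma; split=> //; last first.
  by apply: (qrank_fall (fun m => fnot (psi m))) => m; apply: qrank_fext.
apply/seteqP; split=> M.
  move=> AM; split; last exact: AK.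
  (* This is the empty condition. *)
  have i0 : inj_below (kzero C) id by move=> i j; rewrite ltNge kzero_le.
  have [g [gb _ gA]] := generic M _ _ (AK _ AM) i0.
  have [k [c satg]] := gA.1 AM.
  move=> s; apply/sat_sigma; exists k, c, g; split=> // i j _ _.
  exact: bij_inj.
move=> [Ms KM]; have /sat_sigma[k [c [s [si sats]]]] := Ms id.
have [g [gb sg gA]] := generic M c s KM si.
apply/gA; exists k, c; exact: (sat_agree (phic k c) sg sats).
Qed.

End InvariantSets.

Theorem theorem2p13 (d : Order.disp_t) (kappa : orderType d)
    (kappa_card : infinite_cardinal kappa)
    (kappa_pow : [set: short_seq kappa] #= [set: kappa])
    (L : language) (L_size : [set: L] #<= [set: kappa])
    (K : set (Mod L kappa)) (K_inv : iso_invariant K)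
    (A : set (Mod L kappa)) (AK : A `<=` K) :
  (kplus_borel kappa (trace K A) /\ iso_invariant A <->
     exists2 sigma : formula L kappa,
       sentence sigma & A = Mod_of sigma `&` K) /\
  (kplus_borel kappa (trace K A) -> iso_invariant A ->
     exists sigma : formula L kappa,
       [/\ sentence sigma, A = Mod_of sigma `&` K &
           ole (qrank sigma) (omax (rkB kappa (trace K A)) oone)]).
Proof.
have [C] := exists_kappa_coding kappa_card kappa_pow.
have [dec decP] := fact_code C L_size.
have ranked : kplus_borel kappa (trace K A) -> iso_invariant A ->
     exists sigma : formula L kappa,
       [/\ sentence sigma, A = Mod_of sigma `&` K &
           ole (qrank sigma) (omax (rkB kappa (trace K A)) oone)].
  move=> bA Ainv.
  have [a [[_ aA] aR]] := borel_level_rkB _ (inhabits (kzero C)) bA.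
  suff [sigma [s0 As sa]] : exists sigma : formula L kappa,
      [/\ sentence sigma, A = Mod_of sigma `&` K & ole (qrank sigma) a].
    by exists sigma; split=> //; apply: ole_trans aR.
  case: aA => [sA|pA].
    apply: (vaught_sentence C) => //.
    exact: (vaught_Sigma0 kappa_card C decP).
  (* In the [Pi0] case the relative complement is invariant and of class [Sigma0 a]; negating its
     sentence leaves the rank unchanged. *)
  have nA : vaught a (trace K (K `\` A)).
    have -> : trace K (K `\` A) = ~` trace K A.
      apply/seteqP; split=> x /= => [[]//|nAx]; split=> //; exact: set_valP.
    apply: (vaught_Sigma0 kappa_card C decP).
    by case: pA => b B sB; rewrite setCK.
  have [||sigma [s0 As sa]] := vaught_sentence C a _ _ K_inv _ _ nA.
  - move=> M N MN [KM nAM]; split; first exact: K_inv MN KM.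
    by move=> AN; apply: nAM; apply: Ainv AN; apply: isomorphic_sym.
  - by move=> M [].
  exists (fnot sigma); split=> //.
  apply/seteqP; split=> M.
    move=> AM; split; last exact: AK.
    move=> s sats; have [] : (K `\` A) M; last by [].
    by rewrite As; split; [apply/(sentence_models _ _ s)|apply: AK].
  move=> [nM KM]; apply: contrapT => nAM.
  have : (K `\` A) M by [].
  by rewrite As => -[Ms _]; exact: (nM id (Ms id)).
split=> //; split=> [[bA Ainv]|[sigma s0 As]].
  by have [sigma [s0 As _]] := ranked bA Ainv; exists sigma.
split; last first.
  rewrite As => M N MN [Ms KM]; split; last exact: K_inv MN KM.
  exact: Mod_of_invariant MN Ms.
(* The truth of a sentence can be tested at the single assignment [id]. *)
have -> : trace K A = trace K [set M | sat M id sigma].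
  rewrite As; apply/seteqP; split=> x /= => [[+ _]|satx]; first exact.
  by split; [apply/(sentence_models _ _ id)|apply: set_valP].
exact: kplus_borel_sat.
Qed.
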